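(* Consider the explicit leapfrog method $$\mathbf{M}\,\frac{\mathbf{x}^{n+1}-2\mathbf{x}^n+\mathbf{x}^{n-1}}{h^2}=\mathbf{F}(\mathbf{x}^n)\,\frac{\mathbf{x}^{n+1}-\mathbf{x}^{n-1}}{2h},\qquad \mathbf{u}^n=\frac{\mathbf{x}^{n+1}-\mathbf{x}^{n-1}}{2h},$$ in the case of a quadratic potential $\phi(x)=\tfrac12x^\top Qx+q^\top x$. Provided that the numerical solution $(\mathbf{x}^n,\mathbf{u}^n)$ stays in a fixed compact set, the energy $H(x,\gamma)=\gamma+\phi(x)$ is conserved up to $\mathcal{O}(h^2)$, $$H(x^n,\gamma^n)=H(x^0,\gamma^0)+\mathcal{O}(h^2),$$ over long times $nh\le h^{-N}$ for arbitrary $N\ge1$. The constant symbolized by $\mathcal{O}$ is independent of $n$ and $h$, but depends on the exponent $N$. (That is: for every $N\ge1$ there is a constant $C$, independent of $n$ and $h$, such that $|H(x^n,\gamma^n)-H(x^0,\gamma^0)|\le Ch^2$ for all stepsizes $0<h\le\bar h$ and all $n\ge 0$ with $nh\le h^{-N}$, as long as the numerical solution stays in the compact set.)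
   Context: Let $Q\in\mathbb{R}^{3\times3}$, $q\in\mathbb{R}^3$, $\phi(x)=\tfrac12x^\top Qx+q^\top x$ for $x\in\mathbb{R}^3$, and let the vector potential $A:\mathbb{R}^3\to\mathbb{R}^3$ be arbitrarily differentiable; $E(x)=-\nabla\phi(x)$, $B(x)=\nabla\times A(x)$. Four-dimensional vectors are written $\mathbf{x}^n=(t^n;x^n)$ and $\mathbf{u}^n=(\gamma^n;u^n)$ in $\mathbb{R}\times\mathbb{R}^3$ (as column vectors). Let $\mathbf{M}=\mathrm{diag}(-1,1,1,1)$ and, for $\mathbf{x}=(t;x)$, $$\mathbf{F}(\mathbf{x})=\begin{pmatrix}0&-E(x)^\top\\ E(x)&-\widehat B(x)\end{pmatrix},$$ where $\widehat B(x)v=B(x)\times v$ for all $v\in\mathbb{R}^3$. The stepsize $h>0$ is subject to a fixed upper bound $h\le\bar h$. Equivalently, with $\mathbf{u}^{n+1/2}=(\mathbf{x}^{n+1}-\mathbf{x}^n)/h$ the method reads $\mathbf{M}(\mathbf{u}^{n+1/2}-\mathbf{u}^{n-1/2})=\tfrac h2\mathbf{F}(\mathbf{x}^n)(\mathbf{u}^{n+1/2}+\mathbf{u}^{n-1/2})$, $\mathbf{x}^{n+1}=\mathbf{x}^n+h\mathbf{u}^{n+1/2}$, and $\mathbf{u}^n=\tfrac12(\mathbf{u}^{n+1/2}+\mathbf{u}^{n-1/2})$. Starting procedure: given initial values $(\mathbf{x}^0,\mathbf{u}^0)$ with $\mathbf{u}^0=(\gamma^0;u^0)$, $\gamma^0=\sqrt{1+|u^0|^2}$,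 one takes $u^{1/2}$ to be the last three components of $\mathbf{u}^0+\tfrac h2\mathbf{M}^{-1}\mathbf{F}(\mathbf{x}^0)\mathbf{u}^0$, then $\gamma^{1/2}=\sqrt{1+|u^{1/2}|^2}$ and $\mathbf{u}^{1/2}=(\gamma^{1/2};u^{1/2})$. *)

(* Defs.v *)
From HB Require Import structures.
From mathcomp Require Import all_boot all_order all_algebra.
From mathcomp Require Import all_classical all_reals all_analysis.

Set Implicit Arguments.
Unset Strict Implicit.
Unset Printing Implicit Defensive.

Import Order.TTheory GRing.Theory Num.Theory.
Import numFieldNormedType.Exports.

Local Open Scope classical_set_scope.
Local Open Scope ring_scope.

Section VectorCalculus.
Context {R : realType}.

Implicit Types (f : 'cV[R]_3 -> R) (A : 'cV[R]_3 -> 'cV[R]_3).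

Definition pderiv (i : 'I_3) f : 'cV[R]_3 -> R :=
  fun x => 'D_(delta_mx i 0) f x.

(* C^oo: every iterated partial derivative exists and is Frechet
   differentiable; differentiability at each stage is what makes the total
   operator ['D_v] meaningful at the next one. *)
Definition smooth_fun f : Prop :=
  forall (s : seq 'I_3) (x : 'cV[R]_3), differentiable (foldr pderiv f s) x.

Definition smooth_field A : Prop :=
  forall i : 'I_3, smooth_fun (fun x => A x i 0).

Definition gradient f : 'cV[R]_3 -> 'cV[R]_3 :=
  fun x => \col_i pderiv i f x.

(* Indices in 'I_3 are added modulo 3, so the three components of the curl
   and of the cross product are the cyclic permutations of one formula. *)
Definition curl A : 'cV[R]_3 -> 'cV[R]_3 :=
  fun x => \col_i (pderiv (i + 1) (fun y => A y (i + 2) 0) x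
                   - pderiv (i + 2) (fun y => A y (i + 1) 0) x).

Definition cross (a b : 'cV[R]_3) : 'cV[R]_3 :=
  \col_i (a (i + 1) 0 * b (i + 2) 0 - a (i + 2) 0 * b (i + 1) 0).

Definition hat (b : 'cV[R]_3) : 'M[R]_3 :=
  \matrix_(i, j) cross b (delta_mx j 0) i 0.

Lemma hatE (b v : 'cV[R]_3) : hat b *m v = cross b v.
Proof.
apply/colP => i; rewrite !mxE [v in RHS]matrix_sum_delta.
under eq_bigr do rewrite !mxE.
rewrite !summxE !mulr_sumr -sumrB; apply: eq_bigr => j _.
by rewrite !big_ord1 !mxE mulrBl !mulrA -!mulrA ![_ * v j 0]mulrC.
Qed.

Definition sqnorm (v : 'cV[R]_3) : R := \sum_i v i 0 ^+ 2.

End VectorCalculus.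

(* A vector of R x R^3 is a column of height 1 + 3: [usubmx] is its scalar
   (time or gamma) component and [dsubmx] its spatial component. *)
Section SpaceTime.
Context {R : realType}.

Definition st (s : R) (v : 'cV[R]_3) : 'cV[R]_(1 + 3) := col_mx s%:M v.
Definition tpart (z : 'cV[R]_(1 + 3)) : R := usubmx z 0 0.
Definition xpart (z : 'cV[R]_(1 + 3)) : 'cV[R]_3 := dsubmx z.

Definition lorentz_lift (v : 'cV[R]_3) : 'cV[R]_(1 + 3) :=
  st (Num.sqrt (1 + sqnorm v)) v.

Definition Mmx : 'M[R]_(1 + 3) := block_mx (-1)%:M 0 0 1%:M.

End SpaceTime.

Section Leapfrog.
Context {R : realType}.
Variables (Q : 'M[R]_3) (q : 'cV[R]_3) (A : 'cV[R]_3 -> 'cV[R]_3).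

(* Q is not assumed symmetric. *)
Definition phi (x : 'cV[R]_3) : R :=
  (2^-1 *: (x^T *m Q *m x) + q^T *m x) 0 0.

Definition Efield (x : 'cV[R]_3) : 'cV[R]_3 := - gradient phi x.
Definition Bfield (x : 'cV[R]_3) : 'cV[R]_3 := curl A x.

Definition Fmx (z : 'cV[R]_(1 + 3)) : 'M[R]_(1 + 3) :=
  block_mx 0 (- (Efield (xpart z))^T)
           (Efield (xpart z)) (- hat (Bfield (xpart z))).

Definition energy (x : 'cV[R]_3) (gamma : R) : R := gamma + phi x.

Definition start_velocity (h : R) (x0 u0 : 'cV[R]_(1 + 3)) :
    'cV[R]_(1 + 3) :=
  lorentz_lift (xpart (u0 + (h / 2) *: (invmx Mmx *m Fmx x0 *m u0))).

Definition leapfrog_step (h : R) (xm xc xp : 'cV[R]_(1 + 3)) : Prop :=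
  Mmx *m ((h ^- 2) *: (xp - 2 *: xc + xm))
  = Fmx xc *m ((2 * h)^-1 *: (xp - xm)).

(* The numerical solution up to step n, started from (x0, u0). Only steps
   1, ..., n are required: the linear system defining x^{m+1} need not be
   solvable after the solution has left a given compact set. *)
Definition leapfrog_solution (h : R) (x0 u0 : 'cV[R]_(1 + 3)) (n : nat)
    (x : nat -> 'cV[R]_(1 + 3)) : Prop :=
  [/\ x 0%N = x0,
      x 1%N = x0 + h *: start_velocity h x0 u0 &
      forall m : nat, (m < n)%N -> leapfrog_step h (x m) (x m.+1) (x m.+2)].

Definition velocity (h : R) (u0 : 'cV[R]_(1 + 3))
    (x : nat -> 'cV[R]_(1 + 3)) (n : nat) : 'cV[R]_(1 + 3) :=
  if n is m.+1 then (2 * h)^-1 *: (x m.+2 - x m) else u0.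

(* The compact set constrains the position in R^3 and the four-velocity. The
   component t^n, on which neither F nor the energy depends, is left free: it
   grows at least linearly in n h, so confining it to a compact set would
   exclude long times. *)
Definition stays_in (K : set ('cV[R]_3 * 'cV[R]_(1 + 3))) (h : R)
    (u0 : 'cV[R]_(1 + 3)) (x : nat -> 'cV[R]_(1 + 3)) (n : nat) : Prop :=
  forall m : nat, (m <= n)%N -> K (xpart (x m), velocity h u0 x m).

End Leapfrog.

(* Main.v *)
Require Import Defs.
From HB Require Import structures.
From mathcomp Require Import all_boot all_order all_algebra.
From mathcomp Require Import all_classical all_reals all_analysis.
From mathcomp Require Import ring lra.

(* For a quadratic potential the trapezoidal rule integrates grad phi exactly,
   so psi(x, y) = phi(x) + grad phi(x) . (y - x) / 2 is symmetric in x and y.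
   The gamma row of the scheme reads
     gamma^{n+1/2} - gamma^{n-1/2} = - grad phi(x^n) . (x^{n+1} - x^{n-1}) / 2
                                   = psi(x^{n-1}, x^n) - psi(x^n, x^{n+1}),
   hence gamma^{n+1/2} + psi(x^n, x^{n+1}) is an exact invariant. Averaging it
   over two consecutive half steps gives H(x^n, gamma^n) up to
   h^2/4 grad phi(x^n) . a, where h^2 a is the spatial second difference and
   a is a continuous function of (x^n, u^n), hence bounded on K. At the start,
   a Taylor expansion of sqrt(1 + |u|^2) shows that the invariant equals
   H(x^0, gamma^0) + O(h^2), because u . (B x u) = 0. The bound is therefore
   uniform in n, whatever N. *)

Set Implicit Arguments.
Unset Strict Implicit.
Unset Printing Implicit Defensive.

Import Order.TTheory GRing.Theory Num.Theory.
Import numFieldNormedType.Exports.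

Local Open Scope classical_set_scope.
Local Open Scope ring_scope.

(** * The quadratic potential: gradient and trapezoidal rule *)

Definition dot (R : realType) (a b : 'cV[R]_3) : R := \sum_i a i 0 * b i 0.

(** The linear coefficient is left in coordinates because the gradient is computed from this
    expansion. *)
Lemma phi_along (R : realType) (Q : 'M[R]_3) q (x d : 'cV[R]_3) (t : R) :
  phi Q q (t *: d + x) =
  phi Q q x + t * (2^-1 * \sum_i \sum_j (Q i j + Q j i) * x j 0 * d i 0 + dot q d)
  + t ^+ 2 * (2^-1 * (d^T *m Q *m d) 0 0).
Proof.
rewrite /phi /dot !mxE !big_ord_recl !big_ord0 !mxE !big_ord_recl !big_ord0 !mxE.
by rewrite ?mxE; ring.
Qed.

Lemma gradient_phiE (R : realType) (Q : 'M[R]_3) q (x : 'cV[R]_3) i :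
  gradient (phi Q q) x i 0 = 2^-1 * \sum_j (Q i j + Q j i) * x j 0 + q i 0.
Proof.
rewrite mxE /pderiv /derive.
set d := delta_mx i 0.
have dE (v : 'I_3 -> R) : \sum_k v k * d k 0 = v i.
  rewrite (bigD1 i) //= big1 ?addr0 ?mxE ?eqxx ?mulr1 // => k ki.
  by rewrite mxE (negbTE ki) mulr0.
set a := RHS.
set b := 2^-1 * (d^T *m Q *m d) 0 0.
apply/(@cvg_lim R) => //.
(* For t <> 0 the difference quotient equals [a + t * b], so only the limit of this affine function
   is needed. *)
have : (fun t : R => a + t * b) @ 0^' --> a.
  rewrite -[X in _ --> X]addr0 -[X in _ --> _ + X](mul0r b).
  apply: cvgD; first exact: cvg_cst.
  apply: cvgMl; apply: cvg_within_filter; exact: cvg_id.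
apply: cvg_trans; apply: near_eq_cvg; near=> t.
have t0 : t != 0 by near: t; exact: nbhs_dnbhs_neq.
rewrite /= phi_along /dot dE.
under eq_bigr do rewrite -mulr_suml.
rewrite dE -/b -/a /GRing.scale /=.
by field.
Unshelve. all: by end_near.
Qed.

Lemma phi_expand (R : realType) (Q : 'M[R]_3) q (x d : 'cV[R]_3) (t : R) :
  phi Q q (t *: d + x) = phi Q q x + t * dot (gradient (phi Q q) x) d
    + t ^+ 2 * (2^-1 * (d^T *m Q *m d) 0 0).
Proof.
rewrite phi_along; congr (_ + _ * _ + _).
rewrite /dot mulr_sumr -big_split; apply: eq_bigr => i _ /=.
by rewrite gradient_phiE mulrDl -mulr_suml mulrA.
Qed.

(** Expanding from x along y - x and from y along the opposite direction gives the same quadratic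
    term, which cancels on subtraction. *)
Lemma phi_trapezoid (R : realType) (Q : 'M[R]_3) q (x y : 'cV[R]_3) :
  phi Q q y - phi Q q x =
  2^-1 * (dot (gradient (phi Q q) x) (y - x) + dot (gradient (phi Q q) y) (y - x)).
Proof.
have := phi_expand Q q x (y - x) 1; rewrite scale1r subrK => Ey.
have := phi_expand Q q y (y - x) (-1); rewrite scaleN1r opprB subrK => Ex.
rewrite expr1n mul1r in Ey; rewrite sqrrN expr1n mulN1r mul1r in Ex.
lra.
Qed.

(** * The Euclidean product and the Lorentz factor *)

Section Dot.
Context {R : realType}.
Implicit Types a b c : 'cV[R]_3.

Lemma dotC a b : dot a b = dot b a.
Proof. by apply: eq_bigr => i _; rewrite mulrC. Qed.

Lemma dotDr a b c : dot a (b + c) = dot a b + dot a c.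
Proof. by rewrite -big_split; apply: eq_bigr => i _; rewrite !mxE mulrDr. Qed.

Lemma dotZr a b (s : R) : dot a (s *: b) = s * dot a b.
Proof. by rewrite /dot mulr_sumr; apply: eq_bigr => i _; rewrite !mxE mulrCA. Qed.

Lemma dotNr a b : dot a (- b) = - dot a b.
Proof. by rewrite -scaleN1r dotZr mulN1r. Qed.

Lemma dotBr a b c : dot a (b - c) = dot a b - dot a c.
Proof. by rewrite dotDr dotNr. Qed.

Lemma dotNl a b : dot (- a) b = - dot a b.
Proof. by rewrite dotC dotNr dotC. Qed.

Lemma dotvv a : dot a a = sqnorm a.
Proof. by apply: eq_bigr => i _; rewrite expr2. Qed.

Lemma dot_mx a b : a^T *m b = (dot a b)%:M.
Proof.
apply/matrixP => i j; rewrite !ord1 !mxE eqxx mulr1n.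
by apply: eq_bigr => k _; rewrite !mxE.
Qed.

Lemma dot_cross_self a b : dot b (cross a b) = 0.
Proof.
rewrite /dot !big_ord_recl big_ord0 !mxE addr0.
have -> : lift ord0 ord0 = 1 :> 'I_3 by apply/val_inj.
have -> : lift ord0 (lift ord0 ord0) = 2 :> 'I_3 by apply/val_inj.
have -> : ord0 + 1 = 1 :> 'I_3 by apply/val_inj.
have -> : ord0 + 2 = 2 :> 'I_3 by apply/val_inj.
have -> : 1 + 1 = 2 :> 'I_3 by apply/val_inj.
have -> : 1 + 2 = ord0 :> 'I_3 by apply/val_inj.
have -> : 2 + 1 = ord0 :> 'I_3 by apply/val_inj.
have -> : 2 + 2 = 1 :> 'I_3 by apply/val_inj.
ring.
Qed.

Lemma sqnorm_ge0 a : 0 <= sqnorm a.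
Proof. by apply: sumr_ge0 => i _; apply: sqr_ge0. Qed.

Lemma sqnormD a b : sqnorm (a + b) = sqnorm a + 2 * dot a b + sqnorm b.
Proof. rewrite -!dotvv dotDr ![dot (a + b) _]dotC !dotDr (dotC b a); ring. Qed.

Lemma sqnormZ (s : R) a : sqnorm (s *: a) = s ^+ 2 * sqnorm a.
Proof. rewrite -!dotvv dotZr dotC dotZr; ring. Qed.

Definition lorentz v := Num.sqrt (1 + sqnorm v) : R.

Lemma lorentz_ge1 v : 1 <= lorentz v.
Proof. by rewrite -[leLHS]sqrtr1 ler_wsqrtr // lerDl sqnorm_ge0. Qed.

Lemma lorentz_sqr v : lorentz v ^+ 2 = 1 + sqnorm v.
Proof. by rewrite sqr_sqrtr // addr_ge0 // sqnorm_ge0. Qed.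

(** No derivative of the square root is used: the difference of squares g1^2 - g0^2 is explicit, so
    dividing by g1 + g0 bounds g1 - g0 by k D, and the first-order remainder is exactly (k^2 |w|^2 -
    (g1 - g0)^2) / (2 g0). *)
Lemma lorentz_taylor v w (kbar : R) : exists C : R, forall k, 0 <= k -> k <= kbar ->
  `|lorentz (v + k *: w) - lorentz v - k * dot v w / lorentz v| <= C * k ^+ 2.
Proof.
set g0 := lorentz v.
set D := `|2 * dot v w| + kbar * sqnorm w.
exists (sqnorm w + D ^+ 2) => k k0 kb.
set g1 := lorentz _.
have g0_ge1 : 1 <= g0 by exact: lorentz_ge1.
have g1_ge1 : 1 <= g1 by exact: lorentz_ge1.
have sw := sqnorm_ge0 w.
have E : g1 ^+ 2 - g0 ^+ 2 = k * (2 * dot v w + k * sqnorm w).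
  by rewrite !lorentz_sqr sqnormD dotZr sqnormZ; ring.
have bnd : `|g1 - g0| <= k * D.
  have : `|g1 - g0| * (g1 + g0) = k * `|2 * dot v w + k * sqnorm w|.
    rewrite -[in LHS](ger0_norm (_ : 0 <= g1 + g0)); last lra.
    by rewrite -normrM -subr_sqr E normrM (ger0_norm k0).
  have H1 : `|2 * dot v w + k * sqnorm w| <= D.
    apply: le_trans (ler_normD _ _) _; rewrite lerD2l ger0_norm ?mulr_ge0 //.
    exact: ler_wpM2r.
  have H2 : k * `|2 * dot v w + k * sqnorm w| <= k * D by exact: ler_wpM2l.
  have H3 : `|g1 - g0| * 1 <= `|g1 - g0| * (g1 + g0).
    by apply: ler_wpM2l => //; lra.
  lra.
have sq : (g1 - g0) ^+ 2 <= k ^+ 2 * D ^+ 2.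
  rewrite -exprMn -real_normK ?num_real //.
  by rewrite lerXn2r // nnegrE // (le_trans _ bnd).
have -> : g1 - g0 - k * dot v w / g0
        = (k ^+ 2 * sqnorm w - (g1 - g0) ^+ 2) / (2 * g0).
  have g0n : g0 != 0 by apply/eqP; lra.
  apply: (mulIf (_ : 2 * g0 != 0)); first by rewrite mulf_neq0 // pnatr_eq0.
  rewrite mulfVK ?mulf_neq0 ?pnatr_eq0 //.
  have -> : (g1 - g0 - k * dot v w / g0) * (2 * g0)
     = 2 * g0 * (g1 - g0) - 2 * k * dot v w by field.
  lra.
rewrite normrM normfV (ger0_norm (_ : 0 <= 2 * g0)); last lra.
rewrite ler_pdivrMr; last lra.
have S2 := sqr_ge0 (g1 - g0).
have A1 : 0 <= k ^+ 2 * sqnorm w by rewrite mulr_ge0 // sqr_ge0.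
have A2 : `|k ^+ 2 * sqnorm w - (g1 - g0) ^+ 2| <= (sqnorm w + D ^+ 2) * k ^+ 2.
  by rewrite ler_norml; apply/andP; split; lra.
apply: le_trans A2 _; rewrite ler_peMr //; last lra.
by rewrite mulr_ge0 ?sqr_ge0 // addr_ge0 ?sqr_ge0.
Qed.

End Dot.

(** * Time and space components *)

Section SpaceTimeParts.
Context {R : realType}.
Implicit Types z w : 'cV[R]_(1 + 3).

Lemma tpartE z : tpart z = z (lshift 3 0) 0.
Proof. by rewrite /tpart mxE. Qed.

Lemma tpartD z w : tpart (z + w) = tpart z + tpart w.
Proof. by rewrite !tpartE mxE. Qed.

Lemma tpartN z : tpart (- z) = - tpart z.
Proof. by rewrite !tpartE mxE. Qed.

Lemma tpartZ (s : R) z : tpart (s *: z) = s * tpart z.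
Proof. by rewrite !tpartE mxE. Qed.

Lemma xpartD z w : xpart (z + w) = xpart z + xpart w.
Proof. by rewrite /xpart linearD. Qed.

Lemma xpartN z : xpart (- z) = - xpart z.
Proof. by rewrite /xpart linearN. Qed.

Lemma xpartZ (s : R) z : xpart (s *: z) = s *: xpart z.
Proof. by rewrite /xpart linearZ. Qed.

Lemma tpart_st (s : R) (v : 'cV[R]_3) : tpart (st s v) = s.
Proof. by rewrite /tpart col_mxKu mxE eqxx mulr1n. Qed.

Lemma xpart_st (s : R) (v : 'cV[R]_3) : xpart (st s v) = v.
Proof. by rewrite /xpart col_mxKd. Qed.

Lemma st_parts z : st (tpart z) (xpart z) = z.
Proof. by rewrite /st /tpart /xpart -mx11_scalar vsubmxK. Qed.

Lemma st_inj (s t : R) (v w : 'cV[R]_3) : st s v = st t w -> s = t /\ v = w.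
Proof.
by move=> E; split;
  [rewrite -(tpart_st s v) E tpart_st | rewrite -(xpart_st s v) E xpart_st].
Qed.

Lemma Mmx_st (s : R) (v : 'cV[R]_3) : Mmx *m st s v = st (- s) v.
Proof.
by rewrite mul_block_col !mul0mx addr0 add0r mul1mx -scalar_mxM mulN1r.
Qed.

Lemma invmx_Mmx : invmx Mmx = Mmx :> 'M[R]_(1 + 3).
Proof.
have MM : Mmx *m Mmx = 1%:M :> 'M[R]_(1 + 3).
  rewrite mulmx_block !mul0mx !mulmx0 !addr0 add0r mul1mx -scalar_mxM.
  by rewrite mulrNN mulr1 -scalar_mx_block.
by have [uM _] := mulmx1_unit MM; rewrite -[RHS](mulKmx uM) MM mulmx1.
Qed.

End SpaceTimeParts.

(** * The discrete invariant and its distance to the energy *)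

Section Step.
Context {R : realType}.
Variables (Q : 'M[R]_3) (q : 'cV[R]_3) (A : 'cV[R]_3 -> 'cV[R]_3).
Local Notation F := (Fmx Q q A).
Local Notation E := (Efield Q q).
Local Notation g := (gradient (phi Q q)).

(** The Lorentz force gamma E + u x B, the spatial row of F u. *)
Definition accel (x : 'cV[R]_3) (u : 'cV[R]_(1 + 3)) : 'cV[R]_3 :=
  tpart u *: E x - cross (Bfield A x) (xpart u).

Lemma Fmx_mul z u : F z *m u = st (dot (g (xpart z)) (xpart u)) (accel (xpart z) u).
Proof.
rewrite -{1}(st_parts u) /st mul_block_col mul0mx add0r mul_mx_scalar.
by rewrite !mulNmx hatE dot_mx /Efield dotNl raddfN /= opprK.
Qed.

Lemma leapfrog_step_parts h xm xc xp : h != 0 -> leapfrog_step Q q A h xm xc xp ->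
  tpart (xp - 2 *: xc + xm) =
    - (h / 2) * dot (g (xpart xc)) (xpart xp - xpart xm) /\
  xpart (xp - 2 *: xc + xm) = h ^+ 2 *: accel (xpart xc) ((2 * h)^-1 *: (xp - xm)).
Proof.
move=> h0; rewrite /leapfrog_step Fmx_mul -[X in Mmx *m X]st_parts Mmx_st.
case/st_inj; rewrite xpartZ tpartZ xpartZ xpartD xpartN dotZr => Et Ex.
have h2 : h ^+ 2 != 0 by rewrite expf_neq0.
split; last by rewrite -Ex scalerA mulfV // scale1r.
apply: (mulfI (_ : - h ^- 2 != 0)); first by rewrite oppr_eq0 invr_eq0.
by rewrite mulNr Et; field.
Qed.

(** The function psi of the overview, a value of the potential attached to a half step. *)
Definition mixed_phi (x y : 'cV[R]_3) : R := phi Q q x + 2^-1 * dot (g x) (y - x).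

Lemma mixed_phiC x y : mixed_phi x y = mixed_phi y x.
Proof.
have := phi_trapezoid Q q x y.
rewrite /mixed_phi -(opprB y x) dotNr => T; lra.
Qed.

(** The difference quotient of the time components is gamma at the half step. *)
Definition mid_energy (h : R) (x y : 'cV[R]_(1 + 3)) : R :=
  h^-1 * (tpart y - tpart x) + mixed_phi (xpart x) (xpart y).

(** By symmetry both mixed potentials can be based at the central point; their difference is then
    half of grad phi(x^n) . (x^{n+1} - x^{n-1}), which the time row of the scheme cancels. *)
Lemma mid_energy_step h xm xc xp : h != 0 -> leapfrog_step Q q A h xm xc xp ->
  mid_energy h xc xp = mid_energy h xm xc.
Proof.
move=> h0 /leapfrog_step_parts[] // + _.
rewrite !tpartD tpartN tpartZ => Et.
have T : tpart xp = 2 * tpart xc - tpart xm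
    - h / 2 * dot (g (xpart xc)) (xpart xp - xpart xm) by lra.
rewrite /mid_energy (mixed_phiC (xpart xm)) /mixed_phi T !dotBr.
by field.
Qed.

Lemma mid_energy_const h x n : h != 0 ->
  (forall m, (m < n)%N -> leapfrog_step Q q A h (x m) (x m.+1) (x m.+2)) ->
  forall m, (m <= n)%N -> mid_energy h (x m) (x m.+1) = mid_energy h (x 0%N) (x 1%N).
Proof.
move=> h0 step; elim=> // m IH mn.
by rewrite (mid_energy_step h0 (step m mn)) IH // ltnW.
Qed.

Definition power (p : 'cV[R]_3 * 'cV[R]_(1 + 3)) : R := dot (g p.1) (accel p.1 p.2).

Lemma energy_mid_energy h xm xc xp : h != 0 -> leapfrog_step Q q A h xm xc xp ->
  let u := (2 * h)^-1 *: (xp - xm) in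
  energy Q q (xpart xc) (tpart u) =
  mid_energy h xm xc - h ^+ 2 / 4 * power (xpart xc, u).
Proof.
move=> h0 st /=.
have P := mid_energy_step h0 st.
have [_] := leapfrog_step_parts h0 st.
rewrite /power /=; set u := _ *: (xp - xm) => Ex.
have -> : h ^+ 2 / 4 * dot (g (xpart xc)) (accel (xpart xc) u)
    = 4^-1 * dot (g (xpart xc)) (xpart xp - 2 *: xpart xc + xpart xm).
  rewrite -xpartZ -xpartN -!xpartD Ex dotZr; ring.
(* Averaging the two equal invariants turns the half-step gammas into gamma^n and leaves a quarter
   of grad phi against the second difference. *)
have -> : mid_energy h xm xc = 2^-1 * (mid_energy h xc xp + mid_energy h xm xc).
  rewrite P; lra.
rewrite /mid_energy (mixed_phiC (xpart xm)) /mixed_phi /energy.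
rewrite tpartZ tpartD tpartN !dotDr !dotNr dotZr.
by field.
Qed.

Lemma mid_energy_start (hbar : R) x0 v0 : exists C : R, forall h, 0 < h -> h <= hbar ->
  `|mid_energy h x0 (x0 + h *: start_velocity Q q A h x0 (lorentz_lift v0))
    - energy Q q (xpart x0) (tpart (lorentz_lift v0))| <= C * h ^+ 2.
Proof.
set u0 := lorentz_lift v0; set a := accel (xpart x0) u0.
have [C HC] := lorentz_taylor v0 a (hbar / 2).
(* The first term is the Taylor error at k = h/2; the second comes from the h/2 shift of the
   velocity inside the h/2 grad phi term of [mixed_phi]. *)
exists (C / 4 + `|power (xpart x0, u0)| / 4) => h h0 hb.
have hn : h != 0 by rewrite gt_eqF.
have {HC} := HC (h / 2).
have -> : start_velocity Q q A h x0 u0 = lorentz_lift (v0 + (h / 2) *: a).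
  rewrite /start_velocity -mulmxA Fmx_mul invmx_Mmx Mmx_st.
  by rewrite xpartD xpartZ !xpart_st.
(* The magnetic part is orthogonal to v0. The factor [lorentz v0] cancels the Taylor denominator, so
   the first-order change of gamma is opposite to that of the potential. *)
have -> : dot v0 a = lorentz v0 * dot (g (xpart x0)) v0 * -1.
  rewrite /a /accel dotBr dotZr xpart_st dot_cross_self subr0 tpart_st.
  rewrite /Efield dotNr dotC /lorentz; ring.
have l0 : lorentz v0 != 0 by rewrite gt_eqF // (lt_le_trans ltr01) // lorentz_ge1.
set w := v0 + _; move=> /(_ _ _) Hw.
have {}Hw : `|lorentz w - lorentz v0 + h / 2 * dot (g (xpart x0)) v0| <= C / 4 * h ^+ 2.
  have -> : C / 4 * h ^+ 2 = C * (h / 2) ^+ 2 by field.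
  have -> : h / 2 * dot (g (xpart x0)) v0
     = - (h / 2 * (lorentz v0 * dot (g (xpart x0)) v0 * -1) / lorentz v0) by field.
  by apply: Hw; lra.
have -> : mid_energy h x0 (x0 + h *: lorentz_lift w)
    - energy Q q (xpart x0) (tpart u0)
  = (lorentz w - lorentz v0 + h / 2 * dot (g (xpart x0)) v0)
    + h ^+ 2 / 4 * power (xpart x0, u0).
  rewrite /mid_energy /energy /mixed_phi !tpartD tpartZ xpartD xpartZ !tpart_st xpart_st.
  rewrite -/(lorentz w) -/(lorentz v0) dotBr dotDr dotZr /w dotDr dotZr /power /= -/a.
  by field.
rewrite mulrDl (le_trans (ler_normD _ _)) // lerD //.
rewrite normrM ger0_norm ?divr_ge0 ?sqr_ge0 //; lra.
Qed.

End Step.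

(** * Boundedness of the defect on the compact set *)

Section PowerBound.
Context {R : realType}.
Variables (Q : 'M[R]_3) (q : 'cV[R]_3) (A : 'cV[R]_3 -> 'cV[R]_3).

Lemma continuous_sum (T : topologicalType) n (f : 'I_n -> T -> R) :
  (forall i, continuous (f i)) -> continuous (fun x => \sum_i f i x).
Proof. by move=> cf; apply: continuous_big => //; exact: add_continuous. Qed.

Lemma continuous_pderiv_smooth (f : 'cV[R]_3 -> R) i :
  smooth_fun f -> continuous (pderiv i f).
Proof. by move=> sf x; apply: differentiable_continuous; exact: (sf [:: i] x). Qed.

Lemma continuous_curl : smooth_field A -> forall i, continuous (fun x => curl A x i 0).
Proof.
move=> sA i.
have -> : (fun x => curl A x i 0) = (fun x => pderiv (i + 1) (fun y => A y (i + 2) 0) x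
                   - pderiv (i + 2) (fun y => A y (i + 1) 0) x).
  by apply/funext => x; rewrite mxE.
have cA j k : continuous (pderiv j (fun y => A y k 0)).
  by apply: continuous_pderiv_smooth; exact: sA.
by move=> x; apply: continuousB; exact: cA.
Qed.

Lemma continuous_fun_add (T : topologicalType) (f f' : T -> R) :
  continuous f -> continuous f' -> continuous (fun x => f x + f' x).
Proof. by move=> cf cf' x; apply: cvgD; [exact: cf|exact: cf']. Qed.

Lemma continuous_fun_mul (T : topologicalType) (f f' : T -> R) :
  continuous f -> continuous f' -> continuous (fun x => f x * f' x).
Proof. by move=> cf cf' x; apply: cvgM; [exact: cf|exact: cf']. Qed.

Lemma continuous_fun_opp (T : topologicalType) (f : T -> R) :
  continuous f -> continuous (fun x => - f x).
Proof. by move=> cf x; apply: cvgN; exact: cf. Qed.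

Lemma continuous_grad_phi i : continuous (fun x => gradient (phi Q q) x i 0).
Proof.
have -> : (fun x => gradient (phi Q q) x i 0) =
  (fun x => 2^-1 * \sum_j (Q i j + Q j i) * x j 0 + q i 0).
  by apply/funext => x; rewrite gradient_phiE.
have cst (c : R) : continuous (fun _ : 'cV[R]_3 => c) by exact: cst_continuous.
apply: continuous_fun_add; last exact: cst.
apply: continuous_fun_mul; first exact: cst.
apply: continuous_sum => j.
by apply: continuous_fun_mul; [exact: cst|exact: coord_continuous].
Qed.

Lemma continuous_power : smooth_field A -> continuous (power Q q A).
Proof.
move=> sA.
have c1 (f : 'cV[R]_3 -> R) : continuous f ->
    continuous (fun p : 'cV[R]_3 * 'cV[R]_(1 + 3) => f p.1).
  by move=> cf p; apply: continuous_comp; [exact: cvg_fst|exact: cf].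
have c2 k : continuous (fun p : 'cV[R]_3 * 'cV[R]_(1 + 3) => p.2 k 0).
  move=> p; apply: (@continuous_comp _ _ _ snd (fun z : 'cV[R]_(1 + 3) => z k 0)).
    exact: cvg_snd.
  exact: coord_continuous.
apply: continuous_sum => i.
have cg : continuous (fun p : 'cV[R]_3 * 'cV[R]_(1 + 3) => gradient (phi Q q) p.1 i 0).
  exact: (c1 (fun x => gradient (phi Q q) x i 0) (@continuous_grad_phi i)).
have cB k : continuous (fun p : 'cV[R]_3 * 'cV[R]_(1 + 3) => curl A p.1 k 0).
  exact: (c1 (fun x => curl A x k 0) (@continuous_curl sA k)).
apply: continuous_fun_mul; first exact: cg.
(* Row [lshift 3 0] is gamma and the rows [rshift 1 k] are u: each coordinate is linear in the
   four-velocity with coefficients continuous in x. *)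
have -> : (fun p => accel Q q A p.1 p.2 i 0) = (fun p =>
   p.2 (lshift 3 0) 0 * - gradient (phi Q q) p.1 i 0 +
   - (curl A p.1 (i + 1) 0 * p.2 (rshift 1 (i + 2)) 0 +
    - (curl A p.1 (i + 2) 0 * p.2 (rshift 1 (i + 1)) 0))).
  by apply/funext => y; rewrite /accel /Efield /Bfield tpartE /xpart !mxE.
apply: continuous_fun_add.
  apply: continuous_fun_mul; first exact: c2.
  exact/continuous_fun_opp/cg.
apply: continuous_fun_opp; apply: continuous_fun_add; last apply: continuous_fun_opp.
all: apply: continuous_fun_mul; last exact: c2.
all: exact: cB.
Qed.

Lemma power_bounded K : smooth_field A -> compact K ->
  exists M : R, forall p, K p -> `|power Q q A p| <= M.
Proof.
move=> sA cK.
have /compact_bounded[M [Mr HM]] : compact (power Q q A @` K).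
  apply: continuous_compact => //.
  by apply: continuous_subspaceT; exact: continuous_power.
(* [compact_bounded] gives the bound only for numbers strictly above [M]. *)
exists (M + 1) => p Kp; apply: HM; first by rewrite ltrDl.
by exists p.
Qed.

End PowerBound.

(** * The energy bound, uniform in n *)

Theorem theorem3p3 (R : realType) (Q : 'M[R]_3) (q : 'cV[R]_3)
    (A : 'cV[R]_3 -> 'cV[R]_3) (hA : smooth_field A)
    (x0 : 'cV[R]_(1 + 3)) (v0 : 'cV[R]_3)
    (K : set ('cV[R]_3 * 'cV[R]_(1 + 3))) (hK : compact K)
    (hbar : R) (hbar_gt0 : 0 < hbar) (N : nat) (hN : (1 <= N)%N) :
  exists C : R, forall (h : R) (n : nat) (x : nat -> 'cV[R]_(1 + 3)),
    0 < h -> h <= hbar -> n%:R * h <= h ^- N ->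
    leapfrog_solution Q q A h x0 (lorentz_lift v0) n x ->
    stays_in K h (lorentz_lift v0) x n ->
    `| energy Q q (xpart (x n)) (tpart (velocity h (lorentz_lift v0) x n))
       - energy Q q (xpart x0) (tpart (lorentz_lift v0)) | <= C * h ^+ 2.
Proof.
have [M HM] := power_bounded Q q hA hK.
have [C HC] := mid_energy_start Q q A hbar x0 v0.
(* The maxima make the constant nonnegative, as n = 0 requires. *)
exists (Num.max C 0 + Num.max M 0 / 4) => h n x h0 hb _.
move=> [ex0 ex1 step] /(_ n (leqnn n)) stay.
have hn : h != 0 by rewrite gt_eqF.
case: n step stay => [|m] step stay.
  by rewrite /velocity ex0 subrr normr0 mulr_ge0 ?sqr_ge0 //
    addr_ge0 ?divr_ge0 // le_max lexx orbT.
(* With n = m + 1, step m is centred at x^n; the invariant on (x^m, x^n) is then carried back to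
   (x^0, x^1). *)
rewrite /velocity (energy_mid_energy hn (step m (ltnSn m))).
rewrite (mid_energy_const hn step (leqnSn m)) ex0 ex1 addrAC [leRHS]mulrDl.
rewrite (le_trans (ler_normB _ _)) // lerD //.
  apply: le_trans (HC h h0 hb) _.
  by rewrite ler_wpM2r ?sqr_ge0 // le_max lexx.
have -> : Num.max M 0 / 4 * h ^+ 2 = h ^+ 2 / 4 * Num.max M 0 by ring.
rewrite normrM ger0_norm ?divr_ge0 ?sqr_ge0 // ler_wpM2l ?divr_ge0 ?sqr_ge0 //.
by rewrite (le_trans (HM _ stay)) // le_max lexx.
Qed.
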